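(* Let $k\ge1$, $c\ge0$, and let $X_1,\dots,X_k$ be mutually independent candidates with $f_1(X_i)\ge c$ for all $i$, where $f_1(X)$ is the expected maximum of $k$ independent copies of $X$. Then $$\mathbb{E}(\max(X_1,\dots,X_k))\ge 2c\left(1-e^{-1/2}\right)^2.$$
   Context: A candidate is a nonnegative discrete random variable taking finitely many values. *)

(* Defs.v *)
From HB Require Import structures.
From mathcomp Require Import all_boot all_order all_algebra.
From mathcomp Require Import finmap.
From mathcomp Require Import all_classical all_reals all_analysis.
From mathcomp Require Import measurable_realfun.

Set Implicit Arguments.
Unset Strict Implicit.
Unset Printing Implicit Defensive.

Import Order.TTheory GRing.Theory Num.Theory.

Local Open Scope classical_set_scope.
Local Open Scope ring_scope.

Definition candidate (R : realType) (d : measure_display)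
    (T : measurableType d) (P : probability T R) (X : {RV P >-> R}) : Prop :=
  finite_set (range X) /\ forall w, 0 <= X w.

Definition mutually_independent (R : realType) (d : measure_display)
    (T : measurableType d) (P : probability T R) (I : finType)
    (X : I -> {RV P >-> R}) : Prop :=
  forall (J : {set I}) (B : I -> set R), (forall i, measurable (B i)) ->
    P (\bigcap_(i in [set` J]) (X i @^-1` B i)) =
    (\prod_(i in J) P (X i @^-1` B i))%E.

(* The fold starts from 0, so this is the maximum only for nonnegative
   families; for such families and k >= 1 the initial value is harmless. *)
Definition maxk (R : realType) (k : nat) (x : 'I_k -> R) : R :=
  \big[Num.max/0]_(i < k) x i.

(* Independent copies of X are realized as the coordinates on the finite
   product space (range X)^k, where the point t has mass
   \prod_j P(X = t j); f1_iid below shows that any other choice of independent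
   copies gives the same expected maximum. *)
Definition f1 (R : realType) (k : nat) (d : measure_display)
    (T : measurableType d) (P : probability T R) (X : {RV P >-> R}) : R :=
  \sum_(t : {ffun 'I_k -> fset_set (range X)})
    (\prod_(j < k) pmf X (val (t j))) * maxk (fun j => val (t j)).

Lemma maxk_ge0 (R : realType) (k : nat) (x : 'I_k -> R) : 0 <= maxk x.
Proof. by rewrite /maxk; elim/big_rec : _ => // i y _ y0; rewrite le_max y0 orbT. Qed.

Lemma measurable_maxk (R : realType) (k : nat) (d : measure_display)
    (T : measurableType d) (P : probability T R) (Y : 'I_k -> {RV P >-> R}) :
  measurable_fun setT (fun w => maxk (fun j => Y j w)).
Proof.
rewrite /maxk.
have H (s : seq 'I_k) : measurable_fun setT (fun w => \big[Num.max/0]_(i <- s) Y i w).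
  elim: s => [|i s IH].
    by under eq_fun do rewrite big_nil; exact: measurable_cst.
  by under eq_fun do rewrite big_cons; apply: measurable_maxr.
exact: H.
Qed.

Lemma f1_iid (R : realType) (k : nat) (d d' : measure_display)
    (T : measurableType d) (P : probability T R) (X : {RV P >-> R})
    (T' : measurableType d') (Q : probability T' R)
    (Y : 'I_k -> {RV Q >-> R}) :
  candidate X -> mutually_independent Y ->
  (forall j (B : set R), measurable B ->
     distribution Q (Y j) B = distribution P X B) ->
  'E_Q[fun w => maxk (fun j => Y j w)]%E = (f1 k X)%:E.
Proof.
move=> [finX X0] indY disY.
set S := fset_set (range X).
pose A (t : {ffun 'I_k -> S}) : set T' :=
  \bigcap_(j in [set` [set: 'I_k]%SET]) (Y j @^-1` [set val (t j)]).
have AE t w : A t w <-> forall j, Y j w = val (t j).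
  by split=> [H j|H j _]; [apply: H; rewrite /= inE|exact: H].
have mY j (B : set R) : measurable B -> measurable (Y j @^-1` B).
  by move=> mB; rewrite -[X in measurable X]setTI; exact: measurable_funP.
have mA t : measurable (A t).
  by apply: fin_bigcap_measurable => // j _; apply: mY.
have QA t : Q (A t) = (\prod_(j < k) pmf X (val (t j)))%:E.
  rewrite /A indY; last by move=> i; exact: measurable_set1.
  rewrite -prodEFin; apply: eq_big => [j|j _]; first by rewrite inE.
  rewrite /pmf fineK; first exact: disY.
  by rewrite fin_num_measure// -[X in measurable X]setTI; exact: measurable_funP.
pose D := \big[setU/set0]_(t <- enum {ffun 'I_k -> S}) A t.
have mD : measurable D by apply: bigsetU_measurable.
have DE : D = \bigcap_(j in [set` [set: 'I_k]%SET]) (Y j @^-1` range X).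
  rewrite /D -bigcup_seq; apply/seteqP; split=> w /=.
    move=> [t _ /AE H] j _ /=; rewrite H.
    have := valP (t j); rewrite in_fset_set// inE. by [].
  move=> H.
  have HS j : Y j w \in S.
    by rewrite in_fset_set// inE; apply: H; rewrite /= inE.
  exists [ffun j => [` HS j]%fset]; first by rewrite /= mem_enum.
  by apply/AE => j; rewrite ffunE.
have mrX : measurable (range X).
  exact: countable_measurable (finite_set_countable finX).
have QD : Q D = 1%E.
  rewrite DE indY// big1// => j _.
  have := disY j _ mrX; rewrite /distribution /pushforward => ->.
  exact: probability_range.
have QDC : Q (~` D) = 0%E.
  by rewrite probability_setC// QD -EFinB subrr.
have mM : measurable_fun setT (fun w => (maxk (fun j => Y j w))%:E).
  by apply/measurable_EFinP; exact: measurable_maxk.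
have M0 w : (0 <= (maxk (fun j => Y j w))%:E)%E by rewrite lee_fin maxk_ge0.
rewrite unlock (ge0_negligible_integral (measurableC mD))//.
rewrite setTD setCK ge0_integral_bigsetU//; first last.
- exact: measurable_funS mM.
- move=> t u _ _ [w [/AE Ht /AE Hu]].
  by apply/ffunP => j; apply: val_inj; rewrite -Ht -Hu.
- exact: enum_uniq.
rewrite big_enum/= /f1 -sumEFin; apply: eq_bigr => t _.
rewrite (eq_integral (cst (maxk (fun j => val (t j)))%:E)).
  by rewrite integral_cst// [X in (_ * X)%E](QA t) muleC EFinM.
move=> w; rewrite inE => /AE H /=.
by congr (_%:E); apply: eq_bigr => j _; rewrite H.
Qed.

(* Main.v *)
Require Import Defs.
From mathcomp Require Import all_boot all_order all_algebra.
From mathcomp Require Import finmap.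
From mathcomp Require Import all_classical all_reals all_analysis.
From mathcomp Require Import measurable_realfun.
From mathcomp Require Import lra.

Import Order.TTheory GRing.Theory Num.Theory.

Local Open Scope ring_scope.

(** With [F i v := P (X_i < v)], the layer-cake formula writes the expectation
    of [max_i X_i] as a nonnegative combination over thresholds [v] of
    [1 - \prod_i F i v], and [f1 k (X i)] as the same combination of
    [1 - F i v ^+ k].  By AM-GM, [\prod_i F i v] is at most the average of the
    [F i v ^+ k], so the expected maximum is at least the average of the
    [f1 k (X i)], hence at least [c].  Since [1 - exp (-1/2) <= 1/2], the
    stated constant is at most [1/2]. *)

(** AM-GM for the numbers [F i ^+ k]; comparing [k]-th powers of both sides avoids [k]-th roots. *)
Lemma prod_le_mean_exp (R : realType) (k : nat) (F : 'I_k -> R) :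
  (0 < k)%N -> (forall i, 0 <= F i) ->
  \prod_(i < k) F i <= (\sum_(i < k) F i ^+ k) / k%:R.
Proof.
move=> k0 F0.
rewrite -(ler_pXn2r k0) ?nnegrE; last 2 first.
- by apply: prodr_ge0 => i _.
- by rewrite divr_ge0// sumr_ge0// => i _; rewrite exprn_ge0.
have := @leif_AGM R 'I_k predT (fun i => F i ^+ k).
rewrite /= card_ord => /(_ (fun i _ => exprn_ge0 k (F0 i))) [+ _].
by rewrite prodrXl.
Qed.

(** Telescoping: each weight is the gap between two consecutive entries, and its threshold is the
    upper end of that gap. *)
Lemma path_layer_cake (R : realType) (a : R) (s : seq R) :
  path <%R a s ->
  exists2 W : seq (R * R), {in W, forall w, 0 <= w.1 /\ a < w.2} &
    {in a :: s, forall x, x - a = \sum_(w <- W) w.1 * (w.2 <= x)%R%:R}.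
Proof.
elim: s a => [|b s IH] a /=.
  by move=> _; exists [::] => // x; rewrite inE => /eqP ->; rewrite big_nil subrr.
move=> /andP[ab bs]; have [W W0 WE] := IH b bs.
exists ((b - a, b) :: W).
  move=> w; rewrite inE => /predU1P[->|/W0[w0 bw]] /=.
    by rewrite subr_ge0 ltW.
  by split=> //; exact: lt_trans bw.
move=> x; rewrite inE => /predU1P[->|xs].
  rewrite subrr big1_seq// => w /andP[_]; rewrite inE => /predU1P[->|/W0[_ bw]] /=.
    by rewrite leNgt ab mulr0.
  by rewrite leNgt (lt_trans ab bw) mulr0.
have bx : b <= x.
  move: xs; rewrite inE => /predU1P[->//|].
  move: bs; rewrite lt_path_sortedE => /andP[/allP bs _] /bs /ltW//.
by rewrite big_cons/= bx mulr1 -WE// [RHS]addrC subrKA.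
Qed.

(** The order of quantifiers matters: a single [W] serves every [x], so all the expectations can be
    compared threshold by threshold. *)
Lemma layer_cake (R : realType) (s : seq R) :
  exists2 W : seq (R * R), {in W, forall w, 0 <= w.1 /\ 0 < w.2} &
    {in s, forall x, 0 <= x -> x = \sum_(w <- W) w.1 * (w.2 <= x)%R%:R}.
Proof.
have [|W W0 WE] := @path_layer_cake R 0 (sort <=%R [seq x <- undup s | 0 < x]).
  rewrite lt_path_sortedE sort_lt_sorted filter_uniq ?undup_uniq// andbT.
  by rewrite all_sort filter_all.
exists W => // x xs x0; rewrite -WE ?subr0// inE mem_sort mem_filter mem_undup xs.
by rewrite andbT -le0r.
Qed.

Lemma maxk_mem (R : realType) (k : nat) (x : 'I_k -> R) (s : seq R) :
  0 \in s -> (forall i, x i \in s) -> maxk x \in s.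
Proof.
move=> s0 xs; rewrite /maxk; elim/big_rec : _ => // i y _ ys.
by rewrite /Num.max; case: ifP.
Qed.

(** Positivity of [v] takes care of the start value 0 of the fold. *)
Lemma maxk_lt (R : realType) (k : nat) (x : 'I_k -> R) (v : R) :
  0 < v -> (maxk x < v) = [forall i, x i < v].
Proof.
move=> v0; apply/bigmax_ltP/forallP => [[_ H] i|H]; first exact: H.
by split=> // i _; exact: H.
Qed.

Local Open Scope classical_set_scope.

Section candidate_theory.
Context (R : realType) (d : measure_display) (T : measurableType d).
Context (P : probability T R).
Implicit Types X : {RV P >-> R}.

Lemma measurable_RV_preimage X (B : set R) :
  measurable B -> measurable (X @^-1` B).
Proof. by move=> mB; rewrite -[X in measurable X]setTI; exact: measurable_funP. Qed.

Lemma sum_pmf X (B : set R) : finite_set (range X) -> measurable B ->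
  \sum_(x : fset_set (range X) | val x \in B) pmf X (val x) =
  fine (P (X @^-1` B)).
Proof.
move=> finX mB.
have -> : X @^-1` B = \bigcup_(r in range X) (X @^-1` ([set r] `&` B)).
  apply/seteqP; split=> [w Bw|w [r _ [_ Bw]]//].
  by exists (X w) => //; exists w.
rewrite measure_fin_bigcup//; last 2 first.
- by move=> r r' _ _ [w [[/= <- _] [/= <- _]]].
- by move=> r _; apply: measurable_RV_preimage; apply: measurableI.
rewrite fsbig_finite//= (big_seq_fsetE _ _ predT)/= -sum_fine; last first.
  move=> r _; rewrite fin_num_measure//.
  by apply: measurable_RV_preimage; apply: measurableI.
rewrite big_mkcond; apply: eq_bigr => r _; case: ifPn => [|/negP] rB.
  by rewrite /pmf setIidl// => _ ->; rewrite -inE.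
rewrite (_ : _ `&` B = set0) ?preimage_set0 ?measure0//.
by apply/seteqP; split=> // x [-> Bx]; apply: rB; rewrite inE.
Qed.

(** After the sums are exchanged, each threshold leaves the product mass of the [t] whose maximum
    reaches it; the complementary mass factors over the coordinates. *)
Lemma f1_layer_cake (k : nat) X (W : seq (R * R)) : finite_set (range X) ->
  {in W, forall w, 0 < w.2} ->
  (forall t : {ffun 'I_k -> fset_set (range X)},
    maxk (fun j => val (t j)) =
    \sum_(w <- W) w.1 * (w.2 <= maxk (fun j => val (t j)))%R%:R) ->
  f1 k X = \sum_(w <- W) w.1 * (1 - fine (P (X @^-1` `]-oo, w.2[)) ^+ k).
Proof.
move=> finX W0 WE; rewrite /f1.
under eq_bigr do rewrite WE mulr_sumr.
rewrite exchange_big/= !big_seq; apply: eq_bigr => w wW.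
under eq_bigr do rewrite mulrCA.
rewrite -mulr_sumr; congr (_ * _).
under eq_bigr do rewrite leNgt (maxk_lt _ _ _ _ (W0 _ wW)).
(* Used twice: [B = setT] gives total mass 1, and [B] the open ray below the threshold gives the
   power of the distribution function. *)
have sum_prod (B : set R) : measurable B ->
    \sum_(t : {ffun 'I_k -> fset_set (range X)})
      \prod_(j < k) (pmf X (val (t j)) * (val (t j) \in B)%:R) =
    fine (P (X @^-1` B)) ^+ k.
  move=> mB; rewrite -(bigA_distr_bigA (fun _ r => pmf X (val r) * (val r \in B)%:R)).
  rewrite prodr_const card_ord -sum_pmf// [in RHS]big_mkcond; congr (_ ^+ _).
  by apply: eq_bigr => r _; case: ifP; rewrite ?mulr1 ?mulr0.
have := sum_prod _ measurableT.
rewrite preimage_setT probability_setT/= expr1n => sum1.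
rewrite -[X in X - _]sum1 -(sum_prod _ (measurable_itv _)) -sumrB; apply: eq_bigr => t _.
rewrite !big_split/= -mulrBr; congr (_ * _).
rewrite [in RHS]big1; last by move=> j _; rewrite in_setT.
case: forallP => [H|H] /=.
  by rewrite big1 ?subrr// => j _; rewrite mem_setE in_itv/= H.
have /existsP[j jP] : [exists j, ~~ (val (t j) < w.2)].
  by rewrite -negb_forall; apply/forallP.
by rewrite (bigD1 j)//= mem_setE in_itv/= (negbTE jP) mul0r subr0.
Qed.

(** The maximum stays below [v] exactly on [A v], an intersection whose probability factors by
    independence. *)
Lemma expectation_maxk_layer_cake (k : nat) (X : 'I_k -> {RV P >-> R})
    (W : seq (R * R)) :
  mutually_independent X -> {in W, forall w, 0 <= w.1 /\ 0 < w.2} ->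
  (forall x, maxk (fun i => X i x) =
    \sum_(w <- W) w.1 * (w.2 <= maxk (fun i => X i x))%R%:R) ->
  'E_P[fun x => maxk (fun i => X i x)]%E =
  (\sum_(w <- W) w.1 * (1 - \prod_(i < k) fine (P (X i @^-1` `]-oo, w.2[))))%:E.
Proof.
move=> indX W0 WE; rewrite unlock.
pose A v := \bigcap_(i in [set` [set: 'I_k]%SET]) (X i @^-1` `]-oo, v[).
have mX i v : measurable (X i @^-1` `]-oo, v[).
  by apply: measurable_RV_preimage; exact: measurable_itv.
have mA v : measurable (A v) by apply: fin_bigcap_measurable.
have PA v : P (A v) = (\prod_(i < k) fine (P (X i @^-1` `]-oo, v[)))%:E.
  rewrite /A indX; last by move=> i; exact: measurable_itv.
  rewrite -prodEFin; apply: eq_big => [i|i _]; first by rewrite inE.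
  by rewrite fineK// fin_num_measure.
have indicA w x : w \in W ->
    (w.2 <= maxk (fun i => X i x))%R%:R = \1_(~` A w.2) x :> R.
  move=> /W0[_ w0]; rewrite indicE leNgt maxk_lt// in_setC.
  congr ((~~ _)%:R); apply/forallP/idP.
    by move=> H; rewrite inE => i _ /=; rewrite in_itv/= H.
  by rewrite inE => H i; have := H i; rewrite /= inE in_itv/=; apply.
(* The absolute value changes nothing on [W], but makes the summand nonnegative for every pair [w],
   as exchanging sum and integral requires. *)
rewrite (eq_integral
  (fun x => \sum_(w <- W) (`|w.1|%:E * (\1_(~` A w.2) x)%:E))%E); last first.
  move=> x _; rewrite /= WE -sumEFin !big_seq; apply: eq_bigr => w wW.
  by rewrite indicA// ger0_norm//; have [] := W0 _ wW.
have mI v : measurable_fun setT (fun x => (\1_(~` A v) x : R)%:E).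
  by apply/measurable_EFinP/measurable_indic/measurableC.
rewrite ge0_integral_sum//; last by move=> w; exact: measurable_funeM.
rewrite -sumEFin !big_seq; apply: eq_bigr => w wW.
rewrite ge0_integralZl_EFin//.
rewrite ger0_norm; last by have [] := W0 _ wW.
rewrite integral_indic//; last exact: measurableC.
by rewrite setIT [X in (_ * X)%E](probability_setC P (mA _)) PA.
Qed.

End candidate_theory.

Theorem theorem2p14 (R : realType) (k : nat) (c : R) (d : measure_display)
    (T : measurableType d) (P : probability T R) (X : 'I_k -> {RV P >-> R})
    (hk : (1 <= k)%N) (hc : 0 <= c)
    (hX : forall i : 'I_k, candidate (X i))
    (hind : mutually_independent X)
    (hf1 : forall i : 'I_k, c <= f1 k (X i)) :
  ((2 * c * (1 - expR (- (1 / 2))) ^+ 2)%:E <=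
     'E_P[fun w => maxk (fun i : 'I_k => X i w)])%E.
Proof.
(* All values of all the [X i], together with 0, the start value of [maxk]; hence every maximum that
   occurs lies in [s]. *)
pose s : seq R := 0 :: flatten [seq enum_fset (fset_set (range (X i))) | i <- enum 'I_k].
have sP i r : r \in fset_set (range (X i)) -> r \in s.
  move=> ri; rewrite inE; apply/orP; right; apply/flatten_mapP.
  by exists i; rewrite ?mem_enum.
have [W W0 WE] := @layer_cake R s.
have {}WE x : (forall i, x i \in s) ->
    maxk x = \sum_(w <- W) w.1 * (w.2 <= @maxk R k x)%R%:R.
  by move=> xs; apply: WE; rewrite ?maxk_ge0// maxk_mem// mem_head.
rewrite (@expectation_maxk_layer_cake _ _ _ _ _ _ W)//; last first.
  move=> w; apply: WE => i; apply: (sP i).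
  by rewrite in_fset_set ?inE; [exists w|case: (hX i)].
have {}hf1 i : c <= \sum_(w <- W) w.1 * (1 - fine (P (X i @^-1` `]-oo, w.2[)) ^+ k).
  rewrite -f1_layer_cake//; first by case: (hX i).
  - by move=> w /W0[].
  - by move=> t; apply: WE => j; apply: (sP i); exact: valP.
have k0 : 0 < k%:R :> R by rewrite ltr0n.
have cE : c <= \sum_(w <- W) w.1 * (1 - \prod_(i < k) fine (P (X i @^-1` `]-oo, w.2[))).
  (* Multiplied by [k], the claim follows by summing [hf1] over [i] and applying AM-GM at each
     threshold. *)
  rewrite -(ler_pM2r k0) mulr_natr -[k in c *+ k]card_ord -sumr_const.
  apply: le_trans (ler_sum _ (fun i _ => hf1 i)) _.
  rewrite exchange_big/= mulr_suml big_seq [leRHS]big_seq.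
  apply: ler_sum => w /W0[w0 _].
  rewrite -mulr_sumr -mulrA ler_wpM2l// sumrB sumr_const card_ord mulrBl mul1r.
  rewrite lerB// -ler_pdivlMr//.
  by apply: prod_le_mean_exp => // i; exact: fine_ge0.
rewrite lee_fin; apply: le_trans cE.
(* From [1 - 1/2 <= e <= 1] one gets [0 <= 1 - e <= 1/2], so the factor of [c] is at most 1. *)
have := expR_ge1Dx (- (1 / 2) : R); have := expR_ge0 (- (1 / 2) : R).
have : expR (- (1 / 2) : R) <= 1 by rewrite expR_le1; lra.
set e := expR _ => e1 e0 e2.
rewrite mulrAC -[leRHS]mul1r ler_wpM2r//.
by nra.
Qed.
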